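(* Let $(X,c_X)$ be a Čech closure space, and let $\mathcal{M}_{c_X}$ be the category whose objects are the subspaces $(U,c_U)\subset (X,c_X)$ such that $U$ is the intersection of finitely many subsets of $X$ with non-empty $c_X$-interior, and whose morphisms are the inclusions of subspaces. For each $(U,c_U)\in\mathcal{M}_{c_X}$, define $$\mathrm{Cov}(U,c_U) := \{\mathcal{U}\subset \mathcal{M}_{c_X}/c_U \mid \mathcal{U}\text{ is an interior cover of }(U,c_U)\},$$ where $\mathcal{M}_{c_X}/c_U$ is the slice category of $\mathcal{M}_{c_X}$ over $(U,c_U)$, and $$\mathrm{Cov}(\mathcal{M}_{c_X}) := \{\mathrm{Cov}(U,c_U)\mid (U,c_U)\in\mathcal{M}_{c_X}\}.$$ Then $(\mathcal{M}_{c_X},\mathrm{Cov}(\mathcal{M}_{c_X}))$ is a site on $\mathcal{M}_{c_X}$.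
   Context: A Čech closure space $(X,c_X)$ is a set $X$ with a map $c_X:\mathcal{P}(X)\to\mathcal{P}(X)$ such that $c_X(\varnothing)=\varnothing$, $A\subset c_X(A)$, and $c_X(A\cup B)=c_X(A)\cup c_X(B)$ for all $A,B\subset X$ (idempotence is not required). The interior of $A\subset X$ is $i_X(A):=X\setminus c_X(X\setminus A)$. For $U\subset X$, the subspace closure operator is $c_U(A):=c_X(A)\cap U$ for $A\subset U$, and $(U,c_U)$ is called a subspace of $(X,c_X)$; its interior operator is denoted $i_U$. Category $\mathcal{M}_{c_X}$: objects are the subspaces $(U,c_U)\subset(X,c_X)$ for which there exist finitely many $V_1,\dots,V_n\subset X$ with $i_X(V_k)\neq\varnothing$ and $U=\bigcap_{k=1}^n V_k$. For two objects, $\mathrm{Hom}((V,c_V),(U,c_U))$ consists of the single inclusion map if $V\subset U$ and is empty otherwise. (The empty space is an object iff there are two sets with non-empty interior whose intersection is empty.) Interior cover: a collection $\{\phi_\alpha:(U_\alpha,c_{U_\alpha})\to(U,c_U)\}_{\alpha\in A}$ of objects of the slice category $\mathcal{M}_{c_X}/c_U$ is an interior cover of $(U,c_U)$ iff $U=\bigcup_{\alpha\in A} i_U(\phi_\alpha(U_\alpha))$. Site: a site on a category $\mathcal{C}$ with pullbacks is given by, for every object $U$, a collection $\mathrm{Cov}(U)$ of families of morphisms with target $U$ (coverings) such that: (1) for any isomorphism $U'\to U$, the one-element family $\{U'\to U\}$ is in $\mathrm{Cov}(U)$; (2) if $\{U_\alpha\to U\}_{\alpha\in A}\in\mathrm{Cov}(U)$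 and $V\to U$ is any morphism, then $\{U_\alpha\times_U V\to V\}_{\alpha\in A}\in\mathrm{Cov}(V)$; (3) if $\{f_\alpha:U_\alpha\to U\}_{\alpha\in A}\in\mathrm{Cov}(U)$ and, for each $\alpha$, $\{g_{\alpha\beta}:V_{\alpha\beta}\to U_\alpha\}_{\beta\in B_\alpha}\in\mathrm{Cov}(U_\alpha)$, then $\{f_\alpha\circ g_{\alpha\beta}:V_{\alpha\beta}\to U\}_{\alpha\in A,\beta\in B_\alpha}\in\mathrm{Cov}(U)$. *)

(* Defs.v *)
From mathcomp Require Import all_boot.
From mathcomp Require Import boolp classical_sets.

Set Implicit Arguments.
Unset Strict Implicit.
Unset Printing Implicit Defensive.

Local Open Scope classical_set_scope.

Record category := Category {
  obj :> Type;
  hom : obj -> obj -> Type;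
  idm : forall a, hom a a;
  compm : forall a b c, hom b c -> hom a b -> hom a c;
  comp1m : forall a b (f : hom a b), compm (idm b) f = f;
  compm1 : forall a b (f : hom a b), compm f (idm a) = f;
  compA : forall a b c d (h : hom c d) (g : hom b c) (f : hom a b),
    compm h (compm g f) = compm (compm h g) f
}.
Arguments hom {_} _ _.
Arguments idm {_} _.
Arguments compm {_ _ _ _} _ _.

Definition is_iso (C : category) (a b : C) (f : hom a b) : Prop :=
  exists g : hom b a, compm g f = idm a /\ compm f g = idm b.

Definition is_pullback (C : category) (a b u p : C) (f : hom a u) (g : hom b u)
    (p1 : hom p a) (p2 : hom p b) : Prop :=
  compm f p1 = compm g p2 /\
  forall (t : C) (q1 : hom t a) (q2 : hom t b), compm f q1 = compm g q2 ->
    exists! h : hom t p, compm p1 h = q1 /\ compm p2 h = q2.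

Definition has_pullbacks (C : category) : Prop :=
  forall (a b u : C) (f : hom a u) (g : hom b u),
    exists (p : C) (p1 : hom p a) (p2 : hom p b), is_pullback f g p1 p2.

Section Slice.
Variables (C : category) (u : C).

Record over := Over { dom : C; arr : hom dom u }.

Definition slice_hom (x y : over) := {h : hom (dom x) (dom y) | compm (arr y) h = arr x}.

Lemma slice_homE (x y : over) (h k : slice_hom x y) : sval h = sval k -> h = k.
Proof. by case: h k => [h ?] [k ?] /= e; apply: eq_exist. Qed.

Definition slice_id (x : over) : slice_hom x x := exist _ (idm (dom x)) (compm1 (arr x)).

Lemma slice_comp_subproof (x y z : over) (h : slice_hom y z) (k : slice_hom x y) :
  compm (arr z) (compm (sval h) (sval k)) = arr x.
Proof. by rewrite compA (svalP h) (svalP k). Qed.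

Definition slice_comp (x y z : over) (h : slice_hom y z) (k : slice_hom x y) :
  slice_hom x z := exist _ (compm (sval h) (sval k)) (slice_comp_subproof h k).

Lemma slice_comp1m x y (f : slice_hom x y) : slice_comp (slice_id y) f = f.
Proof. exact/slice_homE/comp1m. Qed.

Lemma slice_compm1 x y (f : slice_hom x y) : slice_comp f (slice_id x) = f.
Proof. exact/slice_homE/compm1. Qed.

Lemma slice_compA x y z t (h : slice_hom z t) (g : slice_hom y z) (f : slice_hom x y) :
  slice_comp h (slice_comp g f) = slice_comp (slice_comp h g) f.
Proof. exact/slice_homE/compA. Qed.

Definition slice : category := Category slice_comp1m slice_compm1 slice_compA.

End Slice.
Arguments Over {_ _ _} _.

Record family (C : category) (u : C) := Family {
  idx : Type;
  member : idx -> slice u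
}.
Arguments Family {_ _ _} _.
Arguments idx {_ _} _.
Arguments member {_ _} _ _.

(* Pullbacks are determined only up to isomorphism, so stability under pullback
   is required for every choice of a pullback of each member. *)
Record is_site (C : category) (Cov : forall u : C, family u -> Prop) : Prop := IsSite {
  site_pullbacks : has_pullbacks C;
  site_iso : forall (u' u : C) (f : hom u' u), is_iso f ->
    Cov u (Family (fun _ : unit => Over f));
  site_pullback : forall (u : C) (F : family u), Cov u F ->
    forall (v : C) (g : hom v u) (P : idx F -> slice v)
      (q : forall i, hom (dom (P i)) (dom (member F i))),
    (forall i, is_pullback (arr (member F i)) g (q i) (arr (P i))) ->
    Cov v (Family P);
  site_comp : forall (u : C) (F : family u), Cov u F ->
    forall G : forall i : idx F, family (dom (member F i)),
    (forall i, Cov (dom (member F i)) (G i)) ->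
    Cov u (Family (fun k : {i : idx F & idx (G i)} =>
      Over (compm (arr (member F (projT1 k))) (arr (member (G (projT1 k)) (projT2 k))))))
}.

Record closure_space := ClosureSpace {
  pts :> Type;
  cl : set pts -> set pts;
  cl0 : cl set0 = set0;
  sub_cl : forall A, A `<=` cl A;
  clU : forall A B, cl (A `|` B) = cl A `|` cl B
}.
Arguments cl {_} _.

Definition interior (X : closure_space) (A : set X) : set X := ~` cl (~` A).

Section Subspace.
Variables (X : closure_space) (U : set X).

(* The points of the subspace form the type {x | x \in U}; the lemma below says
   that this is A |-> c_X(A) `&` U once subsets of U are viewed in X. *)
Definition subspace_cl (A : set U) : set U := val @^-1` cl (val @` A).

Lemma subspace_clE (A : set U) : val @` subspace_cl A = cl (val @` A) `&` U.
Proof.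
apply/seteqP; split => [_ [x clx <-]|x [clx Ux]].
  by split=> //; exact: set_mem (valP x).
by exists (exist _ x (mem_set Ux)).
Qed.

Lemma subspace_cl0 : subspace_cl set0 = set0.
Proof. by rewrite /subspace_cl image_set0 cl0 preimage_set0. Qed.

Lemma sub_subspace_cl A : A `<=` subspace_cl A.
Proof. by move=> x Ax; apply: sub_cl; exists x. Qed.

Lemma subspace_clU A B : subspace_cl (A `|` B) = subspace_cl A `|` subspace_cl B.
Proof. by rewrite /subspace_cl image_setU clU preimage_setU. Qed.

Definition subspace : closure_space :=
  ClosureSpace subspace_cl0 sub_subspace_cl subspace_clU.

End Subspace.

Section InclusionCategory.
Variable X : closure_space.

(* The index type 'I_n.+1 makes the intersection one of at least one set. *)
Record Mobj := MObj {
  Mset :> set X;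
  MsetP : exists (n : nat) (V : 'I_n.+1 -> set X),
    (forall k, interior (V k) !=set0) /\ Mset = \bigcap_k V k
}.

Definition Mspace (U : Mobj) : closure_space := subspace (Mset U).

(* Such an f exists iff V `<=` U, and it is then unique. *)
Definition is_inclusion (V U : Mobj) (f : Mspace V -> Mspace U) : Prop :=
  forall x, val (f x) = val x.

Definition Mhom (V U : Mobj) := {f : Mspace V -> Mspace U | is_inclusion f}.

Lemma Mhom_irr (V U : Mobj) (f g : Mhom V U) : f = g.
Proof.
case: f g => [f fP] [g gP]; apply: eq_exist; apply: funext => x.
by apply: val_inj; rewrite fP gP.
Qed.

Definition Mid (U : Mobj) : Mhom U U := exist (@is_inclusion U U) id (fun=> erefl).

Definition Mcomp (W V U : Mobj) (g : Mhom V U) (f : Mhom W V) : Mhom W U :=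
  exist (@is_inclusion W U) (sval g \o sval f)
    (fun x => etrans (svalP g (sval f x)) (svalP f x)).

Definition Mcat : category :=
  @Category Mobj Mhom Mid Mcomp (fun _ _ _ => Mhom_irr _ _)
    (fun _ _ _ => Mhom_irr _ _) (fun _ _ _ _ _ _ _ => Mhom_irr _ _).

Definition interior_cover (U : Mcat) (F : family U) : Prop :=
  [set: Mspace U] = \bigcup_i interior (X := Mspace U) (range (sval (arr (member F i)))).

Definition Cov (U : Mcat) (F : family U) : Prop := interior_cover F.

End InclusionCategory.

(* Main.v *)
(** Over an object [U], membership of [x] in the relative interior of [V `<=` U]
    says that [x] is not in [c_X (U \ V)].  Stability under pullback is then
    [V \ (U_a & V) `<=` U \ U_a] with monotonicity of [c_X], and stability under
    composition is [U \ W `<=` (U \ V) | (V \ W)] with its additivity. *)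
From mathcomp Require Import all_boot.
From mathcomp Require Import boolp classical_sets.
Require Import Defs.

Set Implicit Arguments.
Unset Strict Implicit.
Unset Printing Implicit Defensive.

Local Open Scope classical_set_scope.

Lemma cl_mono (X : closure_space) (A B : set X) : A `<=` B -> cl A `<=` cl B.
Proof. by move=> AB x Ax; rewrite -((setUidPr A B).2 AB) clU; left. Qed.

Section Objects.
Variable X : closure_space.
Implicit Types U V W : Mcat X.

Lemma Mhom_sub U V (f : hom V U) : Mset V `<=` Mset U.
Proof.
move=> x Vx; have /= <- := svalP f (exist _ x (mem_set Vx)).
exact: set_mem (valP (sval f _)).
Qed.

Lemma sub_Mhom U V : Mset V `<=` Mset U -> inhabited (hom V U).
Proof.
move=> VU; constructor.
by exists (fun x => exist _ (val x) (mem_set (VU _ (set_mem (valP x))))).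
Qed.

(** Concatenating the two finite families that present [U] and [V] presents the intersection, which
    therefore is an object again. *)
Lemma Mset_setI U V : exists W : Mcat X, Mset W = Mset U `&` Mset V.
Proof.
have [n [A [Ai UA]]] := MsetP U; have [m [B [Bi VB]]] := MsetP V.
suff WP : exists (l : nat) (C : 'I_l.+1 -> set X),
    (forall k, interior (C k) !=set0) /\ Mset U `&` Mset V = \bigcap_k C k.
  by exists (MObj WP).
pose C (k : 'I_(n.+1 + m.+1)) := match split k with inl i => A i | inr j => B j end.
(* [(n + m.+1).+1] is convertible to [n.+1 + m.+1], so [C] has the required type. *)
exists (n + m.+1)%N, C; split=> [k|]; first by rewrite /C; case: split.
rewrite UA VB; apply/seteqP; split=> [x [Ax Bx] k _|x Cx].
  by rewrite /C; case: split => i; [exact: Ax|exact: Bx].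
split=> i _.
  by have := Cx (lshift m.+1 i) I; rewrite /C (unsplitK (inl i)).
by have := Cx (rshift n.+1 i) I; rewrite /C (unsplitK (inr i)).
Qed.

(** Parallel arrows are equal, so only the existence of the mediating inclusion has content. *)
Lemma setI_is_pullback U V W (P : Mcat X) (f : hom V U) (g : hom W U)
    (p1 : hom P V) (p2 : hom P W) :
  Mset P = Mset V `&` Mset W -> is_pullback f g p1 p2.
Proof.
move=> PVW; split=> [|T q1 q2 _]; first exact: Mhom_irr.
have [|h] := @sub_Mhom P T.
  by rewrite PVW subsetI; split; [exact: Mhom_sub q1|exact: Mhom_sub q2].
by exists h; split=> [|h' _]; [split|]; exact: Mhom_irr.
Qed.

(** Needed because the site axiom ranges over all pullbacks. Testing the universal property on the
    object with set [V & W] gives an inclusion of that object into [P]. *)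
Lemma pullback_Mset U V W (P : Mcat X) (f : hom V U) (g : hom W U)
    (p1 : hom P V) (p2 : hom P W) :
  is_pullback f g p1 p2 -> Mset P = Mset V `&` Mset W.
Proof.
move=> [_ univ]; apply/seteqP; split.
  by rewrite subsetI; split; [exact: Mhom_sub p1|exact: Mhom_sub p2].
have [T TVW] := Mset_setI V W.
have [|q1] := @sub_Mhom V T; first by rewrite TVW; exact: subIsetl.
have [|q2] := @sub_Mhom W T; first by rewrite TVW; exact: subIsetr.
have [h _] := univ T q1 q2 (Mhom_irr _ _).
by rewrite -TVW; exact: Mhom_sub h.
Qed.

Lemma Mcat_has_pullbacks : has_pullbacks (Mcat X).
Proof.
move=> V W U f g; have [P PVW] := Mset_setI V W.
have [|p1] := @sub_Mhom V P; first by rewrite PVW; exact: subIsetl.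
have [|p2] := @sub_Mhom W P; first by rewrite PVW; exact: subIsetr.
by exists P, p1, p2; exact: setI_is_pullback.
Qed.

Lemma val_setC_range U V (f : hom V U) :
  val @` (~` range (sval f)) = Mset U `\` Mset V.
Proof.
apply/seteqP; split=> [_ [y fy <-]|x [Ux Vx]].
  split; first exact: set_mem (valP y).
  move=> Vy; apply: fy; exists (exist _ (val y) (mem_set Vy)) => //.
  by apply: val_inj; rewrite (svalP f).
exists (exist _ x (mem_set Ux)) => // -[z _ /(congr1 val)].
by rewrite (svalP f) /= => zx; apply: Vx; rewrite -zx; exact: set_mem (valP z).
Qed.

Lemma interior_rangeE U V (f : hom V U) (x : Mspace U) :
  interior (range (sval f)) x = ~ cl (Mset U `\` Mset V) (val x).
Proof. by rewrite -(val_setC_range f). Qed.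

(** Trades subspaces and ranges for subsets of [X] and the one operator [cl]; the covering axioms
    are checked in this form. *)
Lemma interior_coverP U (F : family U) :
  interior_cover F <-> forall x, Mset U x ->
    exists i, ~ cl (Mset U `\` Mset (dom (member F i))) x.
Proof.
split=> [FU x Ux|FU].
  have : [set: Mspace U] (exist _ x (mem_set Ux)) by [].
  by rewrite FU => -[i _]; rewrite interior_rangeE; exists i.
apply/seteqP; split=> // x _.
have [i Fi] := FU _ (set_mem (valP x)).
by exists i => //; rewrite interior_rangeE.
Qed.

End Objects.

Theorem theorem3p3 (X : closure_space) : is_site (@Cov X).
Proof.
split.
- exact: Mcat_has_pullbacks.
- move=> U' U f [g _]; apply/interior_coverP => x _; exists tt => /=.
  (* The inverse [g] is an inclusion of [U] into [U'], so the difference is empty and has empty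
     closure. *)
  by rewrite (_ : _ `\` _ = set0) ?cl0//; rewrite setD_eq0; exact: Mhom_sub g.
- move=> U F /interior_coverP FU V g P q pb; apply/interior_coverP => x Vx.
  have [i Fi] := FU x (Mhom_sub g Vx); exists i => /=.
  apply: contra_not Fi; apply: cl_mono => y [Vy].
  rewrite (pullback_Mset (pb i)) => Py; split; first exact: Mhom_sub g _ Vy.
  by move=> Fy; exact: Py.
- move=> U F /interior_coverP FU G GF; apply/interior_coverP => x Ux.
  have [i Fi] := FU x Ux.
  (* The cover [G i] speaks only of points of its own target; [x] is one, as otherwise it would lie
     in [U] minus that set, hence in its closure. *)
  have Fx : Mset (dom (member F i)) x.
    by apply: contrapT => nFx; apply: Fi; exact: sub_cl.
  have [j Gj] := (interior_coverP _).1 (GF i) x Fx.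
  exists (existT _ i j) => /=.
  suff sub : Mset U `\` Mset (dom (member (G i) j)) `<=`
      (Mset U `\` Mset (dom (member F i))) `|`
      (Mset (dom (member F i)) `\` Mset (dom (member (G i) j))).
    by move=> /(cl_mono sub); rewrite clU => -[].
  by move=> y [Uy Gy]; have [Fy|Fy] := pselect (Mset (dom (member F i)) y);
    [right|left].
Qed.
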